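(* For all integers $n,r$ with $2r\ge n\ge r\ge 6$, $$\mathrm{sat}(n,\mathcal{C}_{\ge r})\ge n+\frac{r}{2}.$$
   Context: All graphs are finite and simple. For an integer $r\ge 3$, $\mathcal{C}_{\ge r}$ denotes the family of all cycles of length at least $r$. For a family $\mathcal{F}$ of graphs, a graph $G$ is $\mathcal{F}$-saturated if $G$ contains no subgraph isomorphic to any member of $\mathcal{F}$, but for every pair of distinct nonadjacent vertices of $G$, adding the edge $e$ joining them yields a graph $G+e$ containing a copy of some member of $\mathcal{F}$ as a subgraph. The saturation number $\mathrm{sat}(n,\mathcal{F})$ is the minimum number of edges in an $n$-vertex $\mathcal{F}$-saturated graph. *)

(* Defs.v *)
From HB Require Import structures.
From mathcomp Require Import all_boot.
From mathcomp Require Import boolp.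

Set Implicit Arguments.
Unset Strict Implicit.
Unset Printing Implicit Defensive.

(* A finite simple graph on T is its set of edges, each a 2-element set. *)
Record sgraph (T : finType) := SGraph {
  edges : {set {set T}};
  edges_card2 : [forall e in edges, #|e| == 2] }.

HB.instance Definition _ (T : finType) := [isSub for @edges T].
HB.instance Definition _ (T : finType) := [Finite of sgraph T by <:].

Lemma sgraph_of_subproof (T : finType) (E : {set {set T}}) :
  [forall e in [set e in E | #|e| == 2], #|e| == 2].
Proof. by apply/forall_inP => e; rewrite inE => /andP[]. Qed.

Definition sgraph_of (T : finType) (E : {set {set T}}) : sgraph T :=
  SGraph (sgraph_of_subproof E).

Definition adj (T : finType) (G : sgraph T) : rel T :=
  fun x y => [set x; y] \in edges G.

Definition add_edge (T : finType) (G : sgraph T) (x y : T) : sgraph T :=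
  sgraph_of ([set x; y] |: edges G).

Definition isomorphic (S T : finType) (H : sgraph S) (G : sgraph T) : Prop :=
  exists2 f : S -> T, bijective f & forall x y, adj G (f x) (f y) = adj H x y.

(* G has a (not necessarily induced) subgraph isomorphic to H. *)
Definition contains (S T : finType) (G : sgraph T) (H : sgraph S) : Prop :=
  exists2 f : S -> T, injective f & forall x y, adj H x y -> adj G (f x) (f y).

Definition graph_family := forall T : finType, sgraph T -> Prop.

Definition contains_member (F : graph_family) (T : finType) (G : sgraph T) :
    Prop :=
  exists (S : finType) (H : sgraph S), F S H /\ contains G H.

Definition saturated (F : graph_family) (T : finType) (G : sgraph T) : Prop :=
  ~ contains_member F G /\
  forall x y : T, x != y -> ~~ adj G x y -> contains_member F (add_edge G x y).

(* The default sgraph_of set0 only matters when no F-saturated graph on n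
   vertices exists; [sat_cycles_geP] rules this out for long cycles. *)
Definition sat (n : nat) (F : graph_family) : nat :=
  #|edges [arg min_(G < sgraph_of set0 :> sgraph 'I_n | `[< saturated F G >])
             #|edges G|]|.

(* [ordS] is the successor modulo k; this is the k-cycle for k >= 3. *)
Definition cycle_graph (k : nat) : sgraph 'I_k :=
  sgraph_of [set [set i; ordS i] | i : 'I_k].

(* Meant for r >= 3, since cycle_graph k is a cycle only for k >= 3. *)
Definition cycles_ge (r : nat) : graph_family :=
  fun T G => exists2 k, r <= k & isomorphic (cycle_graph k) G.

Lemma sat_cycles_geP (n r : nat) : 2 < r ->
  (exists2 G : sgraph 'I_n,
     saturated (cycles_ge r) G & #|edges G| = sat n (cycles_ge r)) /\
  (forall G : sgraph 'I_n,
     saturated (cycles_ge r) G -> sat n (cycles_ge r) <= #|edges G|).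
Proof.
move=> r_gt2; set F := cycles_ge r.
have [G satG] : exists G : sgraph 'I_n, saturated F G.
  have free0 : ~ contains_member F (sgraph_of set0 : sgraph 'I_n).
    move=> [S [H [[k rk [f _ fH]] [g _ gH]]]].
    case: k rk f fH => [|k] rk f fH; first by have := leq_trans r_gt2 rk.
    suff : adj (cycle_graph k.+1) ord0 (ordS ord0).
      by rewrite -fH => /gH; rewrite /adj !inE.
    rewrite /adj /= inE cards2; apply/andP; split; first exact: imset_f.
    suff -> : ord0 != ordS (ord0 : 'I_k.+1) by [].
    rewrite -val_eqE /= modn_small //.
    by have := leq_trans r_gt2 rk; case: (k).
  pose P := [pred G : sgraph 'I_n | `[< ~ contains_member F G >]].
  have P0 : P (sgraph_of set0) by apply/asboolP.
  case: (arg_maxnP (fun G : sgraph 'I_n => #|edges G|) P0) => G /asboolP freeG maxG.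
  exists G; split=> // x y xy nGxy; apply: contrapT => /asboolP /maxG /=.
  suff -> : [set e in [set x; y] |: edges G | #|e| == 2] = [set x; y] |: edges G.
    by rewrite cardsU1 nGxy ltnn.
  apply/setP => e; rewrite !inE andb_idr // => /predU1P[->|].
    by rewrite cards2 xy.
  exact: (forall_inP (edges_card2 G)).
rewrite /sat.
have wit (Q : pred (sgraph 'I_n)) (G0 : sgraph 'I_n) : Q G ->
    extremum_spec leq Q (fun G => #|edges G|)
      [arg min_(H < G0 | Q H) #|edges H|].
  move=> QG; rewrite /arg_min /extremum; case: pickP => [H /andP[QH /forall_inP]|no].
    by move=> leH; split.
  have [H QH minH] := arg_minnP (fun G => #|edges G|) QG.
  by have := no H; rewrite /= QH; case/negP; apply/forall_inP.
have QG : `[< saturated F G >] by apply/asboolP.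
case: (wit (fun G => `[< saturated F G >]) _ QG) => H /asboolP satH minH.
by split; [exists H | move=> G' /asboolP /minH].
Qed.

(* Main.v *)
Require Import Defs.
From mathcomp Require Import all_boot all_order all_algebra.
From mathcomp Require Import zify lra.
Import Order.TTheory GRing.Theory Num.Theory.
Local Open Scope ring_scope.

(* A vertex set W is linked when any two nonadjacent vertices of W are joined
   inside W by a path on at least r vertices.  For saturated G the whole vertex
   set is linked and not a clique, and any such W has degree sum at least
   2 |W| + r.  If W has a cut vertex, both sides are linked: either one of them
   is not a clique and induction applies, or W is two cliques sharing a vertex.

   Otherwise let S be the set of degree 2 vertices of W and H = W \ S.  The two
   neighbours of s in S are adjacent, since a long path between them would avoid
   s and close up through s; hence S is independent and degrees in H are at least
   2 (unless |H| = 2).  The excess over 2 |W| is then at least 2 |S|, which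
   settles 2 |S| >= r.  If 2 |S| < r, the same detour argument shows that the two
   H-neighbours of a vertex of degree 2 in H are adjacent, so the set T2 of these
   vertices is independent and each s has at most one neighbour in T2, while each
   t in T2 has one in S.  Thus |T2| <= |S|, and the degree sum is at least
   4 |S| + 3 |H| - |T2| >= 3 |W|. *)

(** * Degree sums and adjacent pairs between vertex sets *)

Section EdgeCount.
Set Implicit Arguments.
Unset Strict Implicit.
Local Open Scope nat_scope.

Variables (T : finType) (e : rel T).
Hypotheses (e_sym : symmetric e) (e_irr : irreflexive e).
Implicit Types (A B C S W X : {set T}) (x y z : T).

Definition nbrs W x : {set T} := [set y in W | e x y].

(* Ordered adjacent pairs, so that [edge_count W W] is the degree sum. *)
Definition edge_count A B : nat := \sum_(x in A) #|nbrs B x|.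

Definition is_clique W : bool := [forall x in W, forall y in W, (x != y) ==> e x y].

Lemma is_cliqueP W :
  reflect {in W &, forall x y, x != y -> e x y} (is_clique W).
Proof.
apply: (iffP forall_inP) => [cW x y xW yW | cW x xW].
  by move: (forall_inP (cW x xW) y yW) => /implyP.
by apply/forall_inP => y yW; apply/implyP; apply: cW.
Qed.

Lemma edge_countC A B : edge_count A B = edge_count B A.
Proof.
have E C D : edge_count C D = \sum_(x in C) \sum_(y in D) e x y.
  apply: eq_bigr => x _; rewrite -sum1_card big_mkcond /= [RHS]big_mkcond /=.
  by apply: eq_bigr => y _; rewrite inE; case: (y \in D); case: (e x y).
rewrite !E exchange_big /=; apply: eq_bigr => y _; apply: eq_bigr => x _.
by rewrite e_sym.
Qed.

Lemma edge_count_splitl A B C : B \subset A ->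
  edge_count A C = edge_count B C + edge_count (A :\: B) C.
Proof. by move=> /setIidPr sBA; rewrite /edge_count (big_setID B) /= sBA. Qed.

Lemma edge_count_splitr A B C : B \subset A ->
  edge_count C A = edge_count C B + edge_count C (A :\: B).
Proof. by move=> sBA; rewrite edge_countC (edge_count_splitl C sBA) !(edge_countC C). Qed.

Lemma edge_count_split2 W S : S \subset W ->
  edge_count W W = edge_count S S + 2 * edge_count S (W :\: S)
                   + edge_count (W :\: S) (W :\: S).
Proof.
move=> sSW; rewrite (edge_count_splitl _ sSW) !(edge_count_splitr _ sSW).
by rewrite (edge_countC (W :\: S) S); lia.
Qed.

Lemma edge_count_eq0 A B : {in A & B, forall x y, ~~ e x y} -> edge_count A B = 0.
Proof.
move=> nAB; apply: big1 => x xA; apply/eqP; rewrite cards_eq0 -subset0.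
by apply/subsetP => y; rewrite !inE => /andP[yB]; rewrite (negPf (nAB _ _ _ _)).
Qed.

Lemma edge_count_clique W : is_clique W -> edge_count W W = #|W| * #|W|.-1.
Proof.
move=> /is_cliqueP cW; rewrite /edge_count -sum_nat_const; apply: eq_bigr => x xW.
have -> : nbrs W x = W :\ x.
  apply/setP => y; rewrite !inE andbC; case: (boolP (y \in W)) => yW; rewrite ?andbF ?andbT //.
  by case: eqVneq => [->|nyx]; rewrite ?e_irr // cW // eq_sym.
by rewrite (cardsD1 x W) xW.
Qed.

(** The only neighbour of [X] in [W] outside [X] is [c], so every adjacent pair lies in [c |: X] or
    in [W :\: X]. These two sets share only [c], which has no loop, so no pair is counted twice. *)
Lemma edge_count_separation W X c :
  X \subset W -> c \in W -> c \notin X ->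
  {in X & W, forall x y, e x y -> y \in c |: X} ->
  edge_count W W =
  edge_count (c |: X) (c |: X) + edge_count (W :\: X) (W :\: X).
Proof.
move=> sXW cW cX sep.
have sX : X \subset c |: X by apply: subsetUr.
rewrite (edge_count_split2 sXW) (edge_count_split2 sX).
have -> : (c |: X) :\: X = [set c].
  by apply/setP => y; rewrite !inE; case: eqVneq => [->|]; rewrite ?cX // orFb andNb.
have sc : [set c] \subset W :\: X by rewrite sub1set inE cX.
rewrite (edge_count_splitr X sc).
rewrite (@edge_count_eq0 X (W :\: X :\: [set c])); last first.
  move=> x y xX; rewrite !inE => /and3P[ync ynX yW]; apply/negP => /(sep _ _ xX yW).
  by rewrite !inE (negPf ync) (negPf ynX).
rewrite (@edge_count_eq0 [set c] [set c]); first by lia.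
by move=> x y /set1P-> /set1P->; rewrite e_irr.
Qed.

Lemma card_nbrs_split A B x : B \subset A ->
  #|nbrs A x| = #|nbrs B x| + #|nbrs (A :\: B) x|.
Proof.
move=> sBA; rewrite -(cardsID B (nbrs A x)); congr (_ + _); apply: eq_card => y; rewrite !inE.
  case: (boolP (y \in B)) => yB; rewrite ?andbF //.
  by rewrite (subsetP sBA y yB) andbT.
by rewrite andbA.
Qed.

Lemma edge_count_ge A B k : {in A, forall x, k <= #|nbrs B x|} ->
  k * #|A| <= edge_count A B.
Proof. by move=> kA; rewrite mulnC -sum_nat_const; apply: leq_sum. Qed.

End EdgeCount.

(** * Linked sets, one-vertex separations and detours *)

Section NoLongCycle.
Set Implicit Arguments.
Unset Strict Implicit.
Local Open Scope nat_scope.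

Variables (T : finType) (e : rel T) (r : nat).
Hypotheses (e_sym : symmetric e) (e_irr : irreflexive e) (r_ge6 : 6 <= r).
Hypothesis no_long_cycle : forall c, uniq c -> cycle e c -> size c < r.
Implicit Types (A B C S W X : {set T}) (x y z : T) (p : seq T).

(** The path is kept inside [W] so that the property passes to both sides of a cut vertex. *)
Definition linked W : Prop :=
  {in W &, forall x y, x != y -> ~~ e x y ->
    exists p, [/\ path e x p, last x p = y, uniq (x :: p),
                   {subset x :: p <= W} & r <= (size p).+1]}.

Lemma linked_card W : linked W -> ~~ is_clique e W -> r <= #|W|.
Proof.
move=> lW; case: (leqP r #|W|) => // ltW /is_cliqueP[] x y xW yW nxy.
apply: contraTT ltW => nexy; have [p [_ _ up sp rp]] := lW x y xW yW nxy nexy.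
rewrite -leqNgt; apply: leq_trans rp _.
by rewrite -[(size p).+1]/(size (x :: p)) -(card_uniqP up); apply/subset_leq_card/subsetP.
Qed.

(** The first step out of [A] must start at [c]; [belast] records that [c] comes before the end of
    the path. *)
Lemma path_leaves W A c x p :
  (forall x y, x \in A -> y \in W :\: A -> e x y -> x = c) ->
  path e x p -> {subset x :: p <= W} -> x \in A -> last x p \notin A ->
  c \in belast x p.
Proof.
move=> sep; elim: p x => [|y p IHp] x /=; first by move=> _ _ ->.
move=> /andP[exy py] sW xA lA; rewrite inE.
have [yA|yA] := boolP (y \in A).
  by rewrite (IHp y) ?orbT // => z zp; apply: sW; rewrite inE zp orbT.
by rewrite (sep x y) ?eqxx // inE yA sW // !inE eqxx orbT.
Qed.

(** The first step into [A] must land on [c], which is therefore not the starting vertex. *)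
Lemma path_enters W A c x p :
  (forall x y, x \in A -> y \in W :\: A -> e x y -> x = c) ->
  path e x p -> {subset x :: p <= W} -> x \notin A -> last x p \in A ->
  c \in p.
Proof.
move=> sep; elim: p x => [|y p IHp] x /=; first by move=> _ _ /negPf->.
move=> /andP[exy py] sW xA lA; rewrite inE.
have [yA|yA] := boolP (y \in A); last first.
  by rewrite (IHp y) ?orbT // => z zp; apply: sW; rewrite inE zp orbT.
by rewrite (sep y x) ?eqxx //; [rewrite inE xA sW // inE eqxx | rewrite e_sym].
Qed.

(* A path leaving [A] through [c] would have to come back through [c]. *)
Lemma linked_sub W A c : A \subset W ->
  (forall x y, x \in A -> y \in W :\: A -> e x y -> x = c) ->
  linked W -> linked A.
Proof.
move=> /subsetP sAW sep lW x y xA yA nxy nexy.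
have [p [pp lp up sp rp]] := lW x y (sAW _ xA) (sAW _ yA) nxy nexy.
exists p; split=> // z zp; apply: contraT => zA.
have {zp} zp : z \in p by move: zp zA; rewrite inE => /predU1P[->|]; rewrite ?xA.
case/splitPr: zp => p1 p2 in pp lp up sp rp *.
move: pp lp; rewrite cat_path last_cat /= => /and3P[pp1 ez pp2] lp.
have c1 : c \in x :: p1.
  have := @path_leaves W A c x (rcons p1 z) sep; rewrite rcons_path pp1 ez last_rcons.
  rewrite belast_rcons; apply=> // w wp; apply: sp; move: wp.
  by rewrite -rcons_cons mem_rcons !inE mem_cat inE => /or3P[] ->; rewrite ?orbT.
have c2 : c \in p2.
  apply: (@path_enters W A c z p2 sep) => //; last by rewrite lp.
  move=> w wp; apply: sp; move: wp.
  by rewrite !inE mem_cat inE => /orP[] ->; rewrite ?orbT.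
move: up; rewrite -cat_cons cat_uniq => /and3P[_ /hasPn/(_ c) nc _].
by move: nc; rewrite inE c2 orbT c1 => /(_ isT).
Qed.

(* A path from [x] to [b] through [y] would visit at most five vertices, so a
   long one avoids [y] and closes up through [y]. *)
Lemma detour_adj W x y b : linked W -> x \in W -> b \in W -> x != b ->
  e y x -> e y b ->
  (forall u, u \in W -> e y u ->
    [\/ u = x, u = b | forall z, z \in W -> e u z -> [\/ z = y, z = x | z = b]]) ->
  e x b.
Proof.
move=> lW xW bW nxb eyx eyb Hy; apply: contraT => nexb.
have [p [pp lp up sp rp]] := lW x b xW bW nxb nexb.
have nyx : y != x by apply: contraTneq eyx => ->; rewrite e_irr.
have nyb : y != b by apply: contraTneq eyb => ->; rewrite e_irr.
(* This serves both halves of the path, each read outward from [y]: it ends at [b'] and avoids the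
   other end [x']. Its first vertex is [b'], or has only [b'] as possible successor. *)
have aux q x' b' : path e y q -> uniq (y :: q) -> {subset q <= W} -> x' \notin q ->
    last y q = b' -> y != b' -> (x' = x /\ b' = b \/ x' = b /\ b' = x) -> size q <= 2.
  case: q => [//|u q] /= /andP[eyu pq]; rewrite !inE => /and3P[].
  rewrite negb_or => /andP[nyu nyq] nuq uq sq; rewrite negb_or => /andP[nx'u nx'q].
  move=> lq nyb' xb.
  have uW : u \in W by apply: sq; rewrite inE eqxx.
  have end_ v s : v = b' -> v \notin s -> last v s = b' -> s = [::].
    by case: s => //= w s -> nb lb; move: nb; rewrite -lb mem_last.
  have Hu : u = b' \/ forall z, z \in W -> e u z -> [\/ z = y, z = x' | z = b'].
    have [ux|ub|Hz] := Hy u uW eyu.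
    - case: xb => -[xx bb]; first by rewrite xx ux eqxx in nx'u.
      by left; rewrite bb.
    - case: xb => -[xx bb]; last by rewrite xx ub eqxx in nx'u.
      by left; rewrite bb.
    - right=> z zW euz; have [] := Hz z zW euz => ->; first by constructor 1.
        by case: xb => -[-> ->]; [constructor 2 | constructor 3].
      by case: xb => -[-> ->]; [constructor 3 | constructor 2].
  case: Hu => [ub|Hz]; first by rewrite (end_ u q).
  case: q => [//|z q] /= in pq nyq nuq uq sq nx'q lq *.
  move: pq => /andP[euz pq]; have zW : z \in W by apply: sq; rewrite !inE eqxx orbT.
  have [zy|zx|zb] := Hz z zW euz.
  - by rewrite zy inE eqxx in nyq.
  - by rewrite zx inE eqxx in nx'q.
  - by rewrite (end_ z q) //; case/andP: uq.
have [yp|yp] := boolP (y \in p); last first.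
  have := no_long_cycle (c := y :: x :: p).
  rewrite cons_uniq up inE negb_or nyx yp /= rcons_path pp lp eyx e_sym eyb.
  by move=> /(_ isT isT) /=; move: rp; clear; lia.
case/splitPr: yp => p1 p2 in pp lp up sp rp *.
move: pp lp; rewrite cat_path last_cat /= => /and3P[pp1 ey pp2] lp.
move: up; rewrite -cat_cons cat_uniq => /and3P[up1 /hasPn disj up2].
have s2 : size p2 <= 2.
  apply: (aux p2 x b) => //; last by left.
  - by move=> w wp; apply: sp; rewrite inE mem_cat inE wp !orbT.
  - by apply: contraTN (mem_head x p1) => xp2; apply: disj; rewrite inE xp2 orbT.
have s1 : size (rev (x :: p1)) <= 2.
  apply: (aux _ b x) => //; last by right.
  - have := rev_path e x (rcons p1 y); rewrite last_rcons belast_rcons => ->.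
    rewrite (eq_path (e' := e)); last by move=> u v; rewrite e_sym.
    by rewrite rcons_path pp1 ey.
  - by rewrite cons_uniq rev_uniq up1 mem_rev andbT; apply: disj; rewrite mem_head.
  - move=> w; rewrite mem_rev => wp; apply: sp; move: wp.
    by rewrite !inE mem_cat => /orP[->|->]; rewrite ?orbT.
  - by rewrite mem_rev; apply: disj; rewrite -lp mem_last.
  - by rewrite rev_cons last_rcons.
move: rp s1 s2 r_ge6; rewrite size_rev size_cat /=; clear; lia.
Qed.

(** This says that there is no cut vertex, without mentioning components: if [c] alone attaches a
    nonempty [X] to the rest, then the rest is [c]. *)
Definition inseparable W : Prop :=
  forall X c, X \subset W -> X != set0 -> c \in W -> c \notin X ->
    {in X & W, forall x y, e x y -> y \in c |: X} -> W = c |: X.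

(** * Linked sets without a cut vertex *)

Section Inseparable.

Variable W : {set T}.
Hypotheses (lW : linked W) (ncW : ~~ is_clique e W) (iW : inseparable W).

Let rW : r <= #|W| := linked_card lW ncW.

(** Otherwise [[set x]] is separated by its only neighbour, or by any other vertex if it has none,
    and [W] would have just two vertices. *)
Lemma inseparable_deg_ge2 x : x \in W -> 2 <= #|nbrs e W x|.
Proof.
move=> xW; rewrite ltnNge; apply/negP => dx.
suff [c [cW ncx sc]] : exists c, [/\ c \in W, c != x & nbrs e W x \subset [set c]].
  have WE : W = c |: [set x].
    apply: iW; rewrite ?sub1set ?inE //; first by apply/set0Pn; exists x; rewrite inE.
    move=> _ z /set1P-> zW exz; rewrite inE; apply/orP; left.
    by apply: (subsetP sc); rewrite inE zW.
  have := rW; rewrite WE cardsU1 cards1 inE ncx; move: r_ge6; clear; lia.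
have [n0|/set0Pn[c cn]] := eqVneq (nbrs e W x) set0.
  have /set0Pn[c] : W :\ x != set0.
    by rewrite -card_gt0; move: (cardsD1 x W) rW r_ge6; rewrite xW; clear; lia.
  by rewrite !inE => /andP[ncx cW]; exists c; rewrite cW ncx n0 sub0set.
exists c; move: (cn); rewrite inE => /andP[cW exc]; split=> //.
  by apply: contraTneq exc => ->; rewrite e_irr.
apply/subsetP => y yn; rewrite inE; apply/eqP.
by apply: (card_le1_eqP dx).
Qed.

Let S := [set x in W | #|nbrs e W x| == 2].
Let H := W :\: S.

Let sSW : S \subset W.
Proof. by apply/subsetP => x; rewrite inE => /andP[]. Qed.

Let inH x : x \in H -> x \in W.
Proof. by rewrite inE => /andP[]. Qed.

Let inW x : x \in W -> (x \in S) || (x \in H).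
Proof. by rewrite [in x \in H]inE => ->; rewrite andbT orbN. Qed.

Let notSH x : x \in S -> x \in H -> False.
Proof. by rewrite [in x \in H]inE => ->. Qed.

(** The two neighbours of [s] are adjacent by [detour_adj], so every edge at [s] lies in a triangle
    containing all the neighbours of [s]. *)
Lemma deg2_mate s x : s \in S -> x \in W -> e s x ->
  exists y, [/\ y \in W, e s y, e x y & forall z, z \in W -> e s z -> z = x \/ z = y].
Proof.
rewrite inE => /andP[sW /cards2P[u [v [nuv Ns]]]] xW esx.
have inN z : z \in W -> e s z -> z = u \/ z = v.
  move=> zW esz; have : z \in nbrs e W s by rewrite inE zW.
  by rewrite Ns !inE => /orP[]/eqP; [left|right].
have : u \in nbrs e W s by rewrite Ns !inE eqxx.
have : v \in nbrs e W s by rewrite Ns !inE eqxx orbT.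
rewrite !inE => /andP[vW esv] /andP[uW esu].
have euv : e u v.
  apply: (detour_adj lW uW vW nuv esu esv) => w wW esw.
  by case: (inN w wW esw); [constructor 1 | constructor 2].
case: (inN x xW esx) => ->; first by (exists v; split).
by exists u; rewrite (e_sym v); split=> // z zW /(inN z zW)[]; [right|left].
Qed.

(** Adjacent [s] and [s'] would have the same third vertex [y] in their triangles. Then [y]
    separates them from the rest, which forces [W] to have three vertices. *)
Lemma deg2_independent s s' : s \in S -> s' \in S -> ~~ e s s'.
Proof.
move=> sS s'S; apply/negP => ess'.
have [sW s'W] := (subsetP sSW s sS, subsetP sSW s' s'S).
have [y [yW esy es'y Ns]] := deg2_mate sS s'W ess'.
have [z [zW es'z esz Ns']] := deg2_mate s'S sW (etrans (e_sym _ _) ess').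
have ny : y \notin [set s; s'].
  rewrite !inE negb_or; apply/andP; split.
    by apply: contraTneq esy => ->; rewrite e_irr.
  by apply: contraTneq es'y => ->; rewrite e_irr.
have zy : z = y.
  by have [zs'|//] := Ns z zW esz; move: es'z; rewrite zs' e_irr.
subst z.
have WE : W = y |: [set s; s'].
  apply: iW => //.
  - by apply/subsetP => w; rewrite !inE => /orP[]/eqP->.
  - by apply/set0Pn; exists s; rewrite !inE eqxx.
  - move=> w v /set2P[]-> vW; first by move=> /(Ns v vW)[]->; rewrite !inE eqxx ?orbT.
    by move=> /(Ns' v vW)[]->; rewrite !inE eqxx ?orbT.
have := rW; rewrite WE cardsU1 ny cards2; move: r_ge6; clear; lia.
Qed.

Lemma deg2_mate_core s x : s \in S -> x \in W -> e s x ->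
  [/\ x \in H &
   exists y, [/\ y \in H, e s y, e x y & forall z, z \in W -> e s z -> z = x \/ z = y]].
Proof.
move=> sS xW esx; have NS z : z \in W -> e s z -> z \in H.
  move=> zW esz; case/orP: (inW zW) => // zS.
  by move: (deg2_independent sS zS); rewrite esz.
split; first exact: NS.
have [y [yW esy exy Ns]] := deg2_mate sS xW esx.
by exists y; split=> //; apply: NS.
Qed.

Lemma core_nbrs x : x \in H -> 3 <= #|nbrs e S x| + #|nbrs e H x|.
Proof.
move=> xH; rewrite -card_nbrs_split //.
have := inseparable_deg_ge2 (inH xH); rewrite leq_eqVlt => /orP[|//].
by move: xH; rewrite !inE => /andP[xS xW]; move: xS; rewrite xW /= eq_sym => /negPf->.
Qed.

(** If [x] has at most one neighbour in [H], it has one in [S], whose other neighbour [y] is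
    adjacent to [x]. Every neighbour of [x] in [S] then has the same [y], so [y] separates [x] and
    these neighbours, leaving only [x] and [y] in [H]. *)
Lemma core_deg_ge2 x : 3 <= #|H| -> x \in H -> 2 <= #|nbrs e H x|.
Proof.
move=> H3 xH; rewrite ltnNge; apply/negP => dx.
have /card_gt0P[s] : 0 < #|nbrs e S x| by have := core_nbrs xH; move: dx; clear; lia.
rewrite [in s \in _]inE => /andP[sS]; rewrite e_sym => esx.
have xW := inH xH.
have [_ [y [yH esy exy Ns]]] := deg2_mate_core sS xW esx.
have NH z : z \in H -> e x z -> z = y.
  by move=> zH exz; apply: (card_le1_eqP dx); rewrite inE ?yH ?zH.
have nyx : y != x by apply: contraTneq exy => ->; rewrite e_irr.
have WE : W = y |: (x |: nbrs e S x).
  apply: iW.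
  - apply/subsetP => w; rewrite in_setU1 => /orP[/eqP->//|].
    by rewrite inE => /andP[/(subsetP sSW)].
  - by apply/set0Pn; exists x; rewrite setU11.
  - exact: inH.
  - rewrite in_setU1 negb_or nyx; apply/negP; rewrite inE => /andP[yS _].
    exact: notSH yS yH.
  - move=> w v; rewrite in_setU1 => /orP[/eqP->|].
      move=> vW exv; case/orP: (inW vW) => [vS|vH].
        by rewrite !in_setU1 [v \in nbrs _ _ _]inE vS exv !orbT.
      by rewrite (NH v vH exv) setU11.
    rewrite inE => /andP[wS]; rewrite e_sym => ewx vW ewv.
    have [_ [z [zH ewz exz Nw]]] := deg2_mate_core wS xW ewx.
    have [->|->] := Nw v vW ewv; first by rewrite !in_setU1 eqxx orbT.
    by rewrite (NH z zH exz) setU11.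
suff /subset_leq_card : H \subset [set y; x].
  by rewrite cards2; move: H3; case: (y != x); clear; lia.
apply/subsetP => w wH; have := inH wH; rewrite {1}WE !in_setU1 in_set1.
by case/or3P => [->|->|]; rewrite ?orbT // inE => /andP[/notSH/(_ wH)].
Qed.

Let T2 := [set x in H | #|nbrs e H x| == 2].

Let sT2H : T2 \subset H.
Proof. by apply/subsetP => x; rewrite [in x \in T2]inE => /andP[]. Qed.

(** [detour_adj] applies in [W], not just in [H]: a neighbour of [t] in [S] is adjacent only to [t]
    and to one of the two neighbours of [t] in [H], which is the third alternative there. *)
Lemma core_deg2_mate t x : t \in T2 -> x \in H -> e t x ->
  exists y, [/\ y \in H, e t y, e x y & forall z, z \in H -> e t z -> z = x \/ z = y].
Proof.
rewrite [in t \in _]inE => /andP[tH /cards2P[u [v [nuv Nt]]]] xH etx.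
have inN z : z \in H -> e t z -> z = u \/ z = v.
  move=> zH etz; have : z \in nbrs e H t by rewrite inE zH.
  by rewrite Nt !inE => /orP[]/eqP; [left|right].
have : u \in nbrs e H t by rewrite Nt !inE eqxx.
have : v \in nbrs e H t by rewrite Nt !inE eqxx orbT.
rewrite [v \in _]inE [u \in _]inE => /andP[vH etv] /andP[uH etu].
have euv : e u v.
  apply: (detour_adj lW (inH uH) (inH vH) nuv etu etv) => w wW etw.
  case/orP: (inW wW) => [wS|wH]; last first.
    by case: (inN w wH etw); [constructor 1 | constructor 2].
  constructor 3 => z zW ewz.
  have [_ [y [yH ewy ety Nw]]] := deg2_mate_core wS (inH tH) (etrans (e_sym _ _) etw).
  case: (Nw z zW ewz) => ->; first by constructor 1.
  by case: (inN y yH ety); [constructor 2 | constructor 3].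
case: (inN x xH etx) => ->; first by (exists v; split).
by exists u; rewrite (e_sym v); split=> // z zH /(inN z zH)[]; [right|left].
Qed.

(** Adjacent [t] and [t'] share their other neighbour [a] in [H]. Vertices of [S] next to [t] or
    [t'] have both neighbours among [t], [t'], [a], so [a] is a separator and [H] has at most three
    vertices. *)
Lemma core_deg2_independent t t' : 4 <= #|H| -> t \in T2 -> t' \in T2 -> ~~ e t t'.
Proof.
move=> H4 tT t'T; apply/negP => ett'.
have [tH t'H] := (subsetP sT2H t tT, subsetP sT2H t' t'T).
have [a [aH eta et'a Nt]] := core_deg2_mate tT t'H ett'.
have [z [zH et'z etz Nt']] := core_deg2_mate t'T tH (etrans (e_sym _ _) ett').
have za : z = a.
  by have [zt'|//] := Nt z zH etz; move: et'z; rewrite zt' e_irr.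
subst z.
have nat_ : a != t by apply: contraTneq eta => ->; rewrite e_irr.
have nat' : a != t' by apply: contraTneq et'a => ->; rewrite e_irr.
pose X := [set t; t'] :|: (nbrs e S t :|: nbrs e S t').
have inX w : (w \in X) = [|| w == t, w == t' | (w \in S) && (e t w || e t' w)].
  by rewrite in_setU in_set2 in_setU [w \in nbrs _ _ t]inE [w \in nbrs _ _ t']inE
             -andb_orr -orbA.
have WE : W = a |: X.
  apply: iW.
  - apply/subsetP => w; rewrite inX => /or3P[/eqP->|/eqP->|/andP[wS _]]; try exact: inH.
    exact: (subsetP sSW).
  - by apply/set0Pn; exists t; rewrite inX eqxx.
  - exact: inH.
  - rewrite inX (negPf nat_) (negPf nat') /=; apply/negP => /andP[aS _].
    exact: notSH aS aH.
  - move=> w v wX vW ewv; rewrite in_setU1 inX.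
    move: wX; rewrite inX => /or3P[/eqP wt|/eqP wt|/andP[wS /orP[]]].
    + case/orP: (inW vW) => [->|vH]; first by rewrite -wt ewv !orbT.
      by have [->|->] := Nt v vH (etrans (congr1 (e^~ v) (esym wt)) ewv); rewrite eqxx ?orbT.
    + case/orP: (inW vW) => [->|vH]; first by rewrite -wt ewv !orbT.
      by have [->|->] := Nt' v vH (etrans (congr1 (e^~ v) (esym wt)) ewv); rewrite eqxx ?orbT.
    + rewrite e_sym => ewt.
      have [_ [y [yH ewy ety Nw]]] := deg2_mate_core wS (inH tH) ewt.
      have [->|->] := Nw v vW ewv; first by rewrite eqxx orbT.
      by have [->|->] := Nt y yH ety; rewrite eqxx ?orbT.
    + rewrite e_sym => ewt.
      have [_ [y [yH ewy ety Nw]]] := deg2_mate_core wS (inH t'H) ewt.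
      have [->|->] := Nw v vW ewv; first by rewrite eqxx !orbT.
      by have [->|->] := Nt' y yH ety; rewrite eqxx ?orbT.
suff /subset_leq_card : H \subset a |: [set t; t'].
  by rewrite cardsU1 cards2; move: H4; case: (_ \notin _); case: (_ != _); clear; lia.
apply/subsetP => w wH; have := inH wH; rewrite {1}WE !in_setU1 in_set1 inX.
by case/or4P => [->|->|->|]; rewrite ?orbT // => /andP[/notSH/(_ wH)].
Qed.

(** Two such neighbours would be all the neighbours of [s], hence adjacent, against the independence
    of [T2]. *)
Lemma deg2_core_deg2_nbrs s : 4 <= #|H| -> s \in S -> #|nbrs e T2 s| <= 1.
Proof.
move=> H4 sS; rewrite leqNgt; apply/negP => /card_gt1P[t [t' [tN t'N ntt']]].
move: tN t'N; rewrite [in t \in _]inE [in t' \in _]inE => /andP[tT est] /andP[t'T est'].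
have tW := inH (subsetP sT2H t tT); have t'W := inH (subsetP sT2H t' t'T).
have [_ [y [yH esy ety Ns]]] := deg2_mate_core sS tW est.
have [t't|t'y] := Ns t' t'W est'; first by rewrite t't eqxx in ntt'.
by have := core_deg2_independent H4 tT t'T; rewrite t'y ety.
Qed.

Lemma inseparable_edge_count : 2 * #|W| + r <= edge_count e W W.
Proof.
have SS0 : edge_count e S S = 0.
  by apply: edge_count_eq0 => s s'; apply: deg2_independent.
have SH : edge_count e S H = 2 * #|S|.
  have -> : edge_count e S H = edge_count e S W by rewrite (edge_count_splitr e_sym S sSW) SS0.
  rewrite mulnC -sum_nat_const; apply: eq_bigr => s.
  by rewrite inE => /andP[_ /eqP].
have cW : #|S| + #|H| = #|W| by rewrite -(cardsID S W) (setIidPr sSW).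
(* The degree sum is now 4 |S| plus the degree sum inside [H]. *)
rewrite (edge_count_split2 e_sym sSW) SS0 SH -/H.
(* When |H| <= 2, one edge inside [H] suffices: 4 |S| + 2 >= 2 |W| + r follows from |S| >= r - |H|,
   and for |H| = 2 this needs exactly r >= 6. *)
have [H3|H3] := leqP 3 #|H|; last first.
  have /card_gt0P[s sS] : 0 < #|S| by move: cW rW r_ge6 H3; clear; lia.
  have /card_gt0P[x] : 0 < #|nbrs e W s|.
    by apply: leq_trans (inseparable_deg_ge2 (subsetP sSW s sS)).
  rewrite inE => /andP[xW esx].
  have [xH [y [yH esy exy _]]] := deg2_mate_core sS xW esx.
  have nxy : x != y by apply: contraTneq exy => ->; rewrite e_irr.
  have sxyH : [set x; y] \subset H by apply/subsetP => z /set2P[]->.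
  have : 2 <= edge_count e H H.
    rewrite (edge_count_split2 e_sym sxyH) edge_count_clique // ?cards2 ?nxy; last first.
      by apply/is_cliqueP => u v /set2P[]-> /set2P[]->; rewrite ?eqxx // e_sym.
    by rewrite -addnA leq_addr.
  move: cW rW r_ge6 H3; clear; lia.
have HH2 : 2 * #|H| <= edge_count e H H by apply: edge_count_ge => x; apply: core_deg_ge2.
have [rS|rS] := leqP r (2 * #|S|); first by move: HH2 cW rS; clear; lia.
(* Here |H| >= r - |S| > r / 2 >= 3. *)
have H4 : 4 <= #|H| by move: cW rW r_ge6 rS; clear; lia.
have TH : 2 * #|T2| <= edge_count e T2 H.
  by apply: edge_count_ge => t tT; apply: core_deg_ge2 => //; apply: (subsetP sT2H).
have TS : 1 * #|T2| <= edge_count e T2 S.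
  apply: edge_count_ge => t; rewrite inE => /andP[tH /eqP dt].
  by have := core_nbrs tH; rewrite dt; clear; lia.
have ST : edge_count e S T2 <= #|S|.
  rewrite -[X in _ <= X]muln1 -sum_nat_const; apply: leq_sum => s sS.
  exact: deg2_core_deg2_nbrs.
have H3' : 3 * #|H :\: T2| <= edge_count e (H :\: T2) H.
  apply: edge_count_ge => x; rewrite in_setD => /andP[xT xH].
  have := core_deg_ge2 H3 xH; rewrite leq_eqVlt => /orP[|//].
  by move: xT; rewrite inE xH /= eq_sym => /negPf->.
have cH : #|T2| + #|H :\: T2| = #|H| by rewrite -(cardsID T2 H) (setIidPr sT2H).
(* Counting pairs between [T2] and [S] both ways gives |T2| <= |S|; the total is then at least 3
   |W|, and r <= |W|. *)
move: TS ST; rewrite (edge_countC e_sym S) (edge_count_splitl e H sT2H).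
move: TH H3' cH cW rW; clear; lia.
Qed.

End Inseparable.

(** * Induction over cut vertices *)

Lemma linked_edge_count W :
  linked W -> ~~ is_clique e W -> 2 * #|W| + r <= edge_count e W W.
Proof.
have [m] := ubnP #|W|; elim: m W => // m IHm W; rewrite ltnS => Wm lW ncW.
(* For a clique on k >= 1 vertices this is (k - 1)(k - 2) >= 0. The loss of 2 is affordable: the two
   sides share the cut vertex, so their sizes add up to |W| + 1 and one side that is not a clique
   already yields 2 |W| + r. *)
have weak B : linked B -> #|B| < #|W| -> 2 * #|B| <= edge_count e B B + 2.
  move=> lB BW; have [cB|ncB] := boolP (is_clique e B).
    by rewrite edge_count_clique //; case: #|B| => [|[|k]] //=; clear; nia.
  by have := IHm B (leq_trans BW Wm) lB ncB; clear; lia.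
have [] := boolP [exists X : {set T}, exists c, [&& X \subset W, X != set0,
    c \in W, c \notin X, [forall x in X, forall y in W, e x y ==> (y \in c |: X)]
    & W != c |: X]]; last first.
  move=> nsep; apply: inseparable_edge_count => // X c sXW X0 cW cX sep.
  apply/eqP; apply: contraNT nsep => WX; apply/existsP; exists X.
  apply/existsP; exists c; rewrite sXW X0 cW cX WX /= andbT.
  apply/forall_inP => x xX; apply/forall_inP => y yW; apply/implyP; exact: sep.
case/existsP=> X /existsP[c /and5P[sXW X0 cW cX /andP[sepb WX]]].
have sep : {in X & W, forall x y, e x y -> y \in c |: X}.
  by move=> x y xX yW; apply/implyP; apply: (forall_inP (forall_inP sepb x xX)).
have sAW : c |: X \subset W by rewrite subUset sub1set cW.
have sBW : W :\: X \subset W by apply: subsetDl.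
have lA : linked (c |: X).
  apply: (linked_sub sAW (c := c)) lW => x y xA yB exy.
  move: yB xA; rewrite in_setD !in_setU1 => /andP[yA yW] /predU1P[//|xX].
  by move: (sep x y xX yW exy); rewrite in_setU1 (negPf yA).
have lB : linked (W :\: X).
  apply: (linked_sub sBW (c := c)) lW => x y.
  rewrite !in_setD => /andP[xX xW] /andP[yB yW] exy.
  have yX : y \in X by move: yB; rewrite yW andbT negbK.
  have := sep y x yX xW; rewrite e_sym => /(_ exy).
  by rewrite in_setU1 (negPf xX) orbF => /eqP.
have cA : #|c |: X| = #|X|.+1 by rewrite cardsU1 cX.
have cB : #|X| + #|W :\: X| = #|W| by rewrite -(cardsID X W) (setIidPr sXW).
have X_gt0 : 0 < #|X| by rewrite card_gt0.
have ltA : #|c |: X| < #|W| by apply: proper_card; rewrite properEneq eq_sym WX.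
have ltB : #|W :\: X| < #|W| by move: cB X_gt0; clear; lia.
rewrite (edge_count_separation e_sym e_irr sXW cW cX sep).
have [clA|nclA] := boolP (is_clique e (c |: X)); last first.
  have := IHm _ (leq_trans ltA Wm) lA nclA; have := weak _ lB ltB.
  by move: cA cB; clear; lia.
have [clB|nclB] := boolP (is_clique e (W :\: X)); last first.
  have := IHm _ (leq_trans ltB Wm) lB nclB; have := weak _ lA ltA.
  by move: cA cB; clear; lia.
(* With u = |X| - 1 and v = |W \ X| - 2 this reads u^2 + v^2 >= 5 for u + v >= 3. *)
rewrite !edge_count_clique // cA; move: (linked_card lW ncW) cB X_gt0 ltA r_ge6.
rewrite cA; case: #|X| => [//|u]; case: #|_ :\: _| => [|[|v]] rW cB _ ltA r6.
- by move: cB ltA; clear; lia.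
- by move: cB ltA; clear; lia.
have : 5 <= u * u + v * v.
  by move: u v cB r6 rW {ltA} => [|[|u]] [|[|v]]; clear; nia.
by move: cB rW; clear; nia.
Qed.

End NoLongCycle.

(** * From saturated graphs to linked sets *)

Section LongCycleSaturated.
Set Implicit Arguments.
Unset Strict Implicit.
Local Open Scope nat_scope.

Lemma set2_inj (T : finType) (u v x y : T) : [set u; v] = [set x; y] ->
  u = x /\ v = y \/ u = y /\ v = x.
Proof.
move=> E.
have /set2P uxy : u \in [set x; y] by rewrite -E set21.
have /set2P vxy : v \in [set x; y] by rewrite -E set22.
have /set2P xuv : x \in [set u; v] by rewrite E set21.
have /set2P yuv : y \in [set u; v] by rewrite E set22.
by case: uxy vxy xuv yuv => [->|->] [->|->] [?|?] [?|?]; solve [by left | by right].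
Qed.

(** The successor modulo the size matches [ordS] in [cycle_graph]. *)
Lemma cycle_nthP (T : eqType) (e : rel T) (x0 : T) (c : seq T) :
  reflect (forall i, i < size c -> e (nth x0 c i) (nth x0 c (i.+1 %% size c)))
          (cycle e c).
Proof.
case: c => [|x q]; first by left.
have E i : i < size (x :: q) -> nth x0 (x :: rcons q x) i = nth x0 (x :: q) i /\
    nth x0 (rcons q x) i = nth x0 (x :: q) (i.+1 %% size (x :: q)).
  move=> iq; rewrite -rcons_cons !nth_rcons iq; split=> //.
  move: iq; rewrite /= ltnS leq_eqVlt => /predU1P[->|iq].
    by rewrite ltnn eqxx modnn.
  by rewrite iq modn_small.
apply: (iffP (pathP x0)) => H i; rewrite ?size_rcons => iq.
  by have [<- <-] := E i iq; apply: H; rewrite size_rcons.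
by have [-> ->] := E i iq; apply: H.
Qed.

(** Some consecutive pair of [c] is not [e]-adjacent, so it is the new edge. Rotating [c] to start
    there and dropping that edge leaves a path through all its vertices. *)
Lemma cycle_new_edge (T : eqType) (e e' : rel T) (x y : T) (c : seq T) :
  symmetric e -> uniq c -> 2 < size c ->
  (forall u v, e' u v -> [\/ e u v, u = x /\ v = y | u = y /\ v = x]) ->
  cycle e' c -> ~~ cycle e c ->
  exists p, [/\ path e x p, last x p = y, uniq (x :: p) & (size p).+1 = size c].
Proof.
move=> e_sym uc sc e'P cyc' ncyc.
have [u uc' nuv] : exists2 u, u \in c & ~~ e u (next c u).
  apply/hasP; rewrite -[has _ _]negbK -all_predC; apply: contra ncyc => /allP H.
  by apply: cycle_from_next => // u /H /=; rewrite negbK.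
have [i q cE] := rot_to uc'.
have sq : size (u :: q) = size c by rewrite -cE size_rot.
case: q => [|v q] in cE sq *; first by rewrite -sq in sc.
have nv : next c u = v by rewrite -(next_rot i) // cE /= eqxx.
rewrite nv in nuv.
have uq : uniq [:: u, v & q] by rewrite -cE rot_uniq.
have cq : cycle e' [:: u, v & q] by rewrite -cE rot_cycle.
move: cq => /= /andP[e'uv]; rewrite rcons_path => /andP[pq e'qu].
have uvxy : u = x /\ v = y \/ u = y /\ v = x.
  by case: (e'P u v e'uv) => [euv|H|H]; [rewrite euv in nuv | left | right].
have e'e a b : e' a b -> (a == u) && (b == v) || (a == v) && (b == u) || e a b.
  move=> /e'P[->|[-> ->]|[-> ->]]; first by rewrite orbT.
    by case: uvxy => -[-> ->]; rewrite !eqxx ?orbT.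
  by case: uvxy => -[-> ->]; rewrite !eqxx ?orbT.
move: uq; rewrite /= => /and3P[uvq vq uq].
have {}pq : path e v q.
  apply: (@sub_in_path _ (predC1 u) e' e) pq.
    move=> a b; rewrite !inE => /negPf na /negPf nb /e'e.
    by rewrite na nb andbF.
  by apply/allP => w wq; apply: contraNneq uvq => <-.
(* If the closing step were the new edge again, the last vertex would be [u] or [v], against [uniq]
   or the size being above 2. *)
have lq : e (last v q) u.
  have /orP[|//] := e'e _ _ e'qu; rewrite eqxx andbT => /orP[/andP[/eqP lu _]|/eqP lv].
    by move: uvq; rewrite -lu mem_last.
  case: (q) sq vq lv => [|w s] /=; first by move=> sq; rewrite -sq in sc.
  by move=> _ + lv; rewrite -lv mem_last.
have P1 : path e v (rcons q u) by rewrite rcons_path pq.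
have U1 : uniq (v :: rcons q u).
  by rewrite -rcons_cons rcons_uniq uvq /= vq.
case: uvxy => -[ux vy]; last first.
  by exists (rcons q u); rewrite -vy -ux last_rcons size_rcons.
(* The cycle runs through the new edge from [x] to [y], so the path from [x] to [y] goes round the
   other way. *)
exists (rev (v :: q)); rewrite -ux -vy; split.
- have := rev_path e v (rcons q u); rewrite last_rcons belast_rcons => ->.
  by rewrite (eq_path (e' := e)) // => a b; rewrite e_sym.
- by rewrite rev_cons last_rcons.
- by rewrite /= rev_uniq mem_rev uvq /= vq.
- by rewrite size_rev -sq.
Qed.

Section Graph.
Variables (T : finType) (G : sgraph T).

Lemma adj_sym : symmetric (adj G).
Proof. by move=> x y; rewrite /adj setUC. Qed.

Lemma adj_irr : irreflexive (adj G).
Proof.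
move=> x; apply/negP => /(forall_inP (edges_card2 G)).
by rewrite setUid cards1.
Qed.

(** Both sides are compared through vertex-edge incidences: for fixed [x], sending a neighbour [y]
    to [[set x; y]] is injective into the edges at [x]. *)
Lemma edge_count_le : edge_count (adj G) setT setT <= 2 * #|edges G|.
Proof.
have -> : 2 * #|edges G| = \sum_(E in edges G) #|E|.
  rewrite mulnC -sum_nat_const; apply: eq_bigr => E.
  by move=> /(forall_inP (edges_card2 G))/eqP.
have -> : \sum_(E in edges G) #|E| = \sum_x #|[set E in edges G | x \in E]|.
  transitivity (\sum_(E in edges G) \sum_x (x \in E : nat)).
    by apply: eq_bigr => E _; rewrite -sum1_card big_mkcond.
  rewrite exchange_big /=; apply: eq_bigr => x _.
  by rewrite -sum1_card big_mkcond [RHS]big_mkcond /=; apply: eq_bigr => E _;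
    rewrite inE; case: (E \in _); case: (x \in E).
rewrite /edge_count (eq_bigl xpredT); last by move=> x; rewrite inE.
apply: leq_sum => x _.
rewrite -(@card_imset _ _ (fun y => [set x; y])); last first.
  by move=> y z /set2_inj[[]|[->]].
apply/subset_leq_card/subsetP => E /imsetP[y]; rewrite inE => /andP[_ xy] ->.
by rewrite inE set21 andbT.
Qed.

Lemma cycle_graph_adjS k (i : 'I_k) : 1 < k -> adj (cycle_graph k) i (ordS i).
Proof.
move=> k1; rewrite /adj /= inE cards2; apply/andP; split; first exact: imset_f.
suff -> : i != ordS i by [].
rewrite -val_eqE /=; have := ltn_ord i; rewrite leq_eqVlt => /predU1P[ik|ik].
  by rewrite ik modnn; apply: contraTneq k1 => i0; rewrite -leqNgt -ik i0.
by rewrite modn_small // neq_ltn leqnn.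
Qed.

(** This replaces embedded copies of cycle graphs by duplicate-free vertex sequences, the form used
    by the counting argument. *)
Lemma contains_cycleP r : 1 < r ->
  contains_member (cycles_ge r) G <->
  exists c, [/\ uniq c, cycle (adj G) c & r <= size c].
Proof.
move=> r1; split=> [[S [H [[k rk [h hb hH]] [g gi gH]]]] | [c [uc cc rc]]].
  have k1 := leq_trans r1 rk.
  exists [seq g (h i) | i <- enum 'I_k].
  rewrite map_inj_uniq ?enum_uniq; last first.
    by move=> i j /gi/(bij_inj hb).
  split=> //; last by rewrite size_map -?enumT size_enum_ord.
  case: k => [//|k] in h hb hH rk k1 *.
  apply/(cycle_nthP _ (g (h ord0))) => i; rewrite size_map size_enum_ord => ik.
  rewrite !(nth_map ord0) -?enumT ?size_enum_ord ?ltn_pmod //.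
  apply: gH; rewrite hH -?enumT.
  have -> : nth ord0 (enum 'I_k.+1) (i.+1 %% k.+1) = ordS (nth ord0 (enum 'I_k.+1) i).
    by apply: val_inj; rewrite /= !nth_enum_ord // ltn_pmod.
  exact: cycle_graph_adjS.
exists 'I_(size c), (cycle_graph (size c)); split.
  by exists (size c) => //; exists id => //; exists id.
have [x0 _] : exists x0, x0 \in c.
  by case: c rc {uc cc} => [|x c _]; [case: (r) r1 | exists x; rewrite inE eqxx].
exists (fun i : 'I_(size c) => nth x0 c i) => [i j /eqP|i j].
  by rewrite nth_uniq // => /eqP/val_inj.
have cN := cycle_nthP (adj G) x0 c cc.
rewrite {1}/adj inE => /andP[/imsetP[l _ /set2_inj[[-> ->]|[-> ->]]] _].
  exact: cN.
by rewrite adj_sym; apply: cN.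
Qed.

End Graph.

Lemma saturated_edges (T : finType) (G : sgraph T) r : 6 <= r -> r <= #|T| ->
  saturated (cycles_ge r) G -> 2 * #|T| + r <= 2 * #|edges G|.
Proof.
move=> r6 rT [freeG satG]; have r1 : 1 < r by apply: leq_trans r6.
have noc c : uniq c -> cycle (adj G) c -> size c < r.
  move=> uc cc; rewrite ltnNge; apply/negP => rc; apply: freeG.
  by apply/contains_cycleP => //; exists c.
(* In a complete graph the enumeration of all vertices is a cycle of length |T| >= r. *)
have nclique : ~~ is_clique (adj G) setT.
  apply/negP => /is_cliqueP clG.
  have /card_gt0P[x0 _] : 0 < #|T| by apply: leq_trans rT; apply: leq_trans r6.
  have := noc (enum T) (enum_uniq T); rewrite -cardE ltnNge rT.
  move=> clF; suff /clF : cycle (adj G) (enum T) by []; apply/(cycle_nthP _ x0) => i; rewrite -cardE => iT.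
  apply: clG; rewrite ?inE // nth_uniq ?enum_uniq -?cardE ?ltn_pmod //; last first.
    exact: leq_ltn_trans iT.
  move: iT; rewrite leq_eqVlt => /predU1P[iT|iT].
    by rewrite iT modnn; move: (leq_trans r1 rT); rewrite -iT; case: (i).
  by rewrite modn_small // neq_ltn leqnn.
(* The long cycle created by adding an edge must use that edge, since [G] has none; removing it
   leaves a path on at least [r] vertices. *)
have lG : linked (adj G) r setT.
  move=> x y _ _ nxy nadj; have /contains_cycleP[//|c [uc cc rc]] := satG x y nxy nadj.
  have [||| p [pp lp up sp]] := @cycle_new_edge _ (adj G) _ x y c (@adj_sym _ G) uc _ _ cc _.
  - by apply: leq_trans rc; apply: leq_trans r6.
  - move=> u v; rewrite /adj inE => /andP[/setU1P[/set2_inj[H|H]|H] _].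
    + by constructor 2.
    + by constructor 3.
    + by constructor 1.
  - by apply/negP => /(noc c uc); rewrite ltnNge rc.
  - by exists p; split=> // [z _|]; rewrite ?sp ?in_setT.
have := linked_edge_count (@adj_sym _ G) (@adj_irr _ G) r6 noc lG nclique.
by rewrite cardsT => /leq_trans; apply; apply: edge_count_le.
Qed.

End LongCycleSaturated.

Theorem theorem1p4 (n r : nat) (hr : (6 <= r)%N) (hrn : (r <= n)%N)
    (hn2r : (n <= 2 * r)%N) :
  n%:R + r%:R / 2%:R <= (sat n (cycles_ge r))%:R :> rat.
Proof.
have [[G satG <-] _] := sat_cycles_geP n (leq_trans (isT : (2 < 6)%N) hr).
have := saturated_edges hr _ satG; rewrite card_ord => /(_ hrn).
rewrite -(ler_nat rat) natrD !natrM; lra.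
Qed.
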